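(* Let $\tilde r_i=r_i-\bar r$ denote mean-centered scores. Applying the score-weighted attention construction (defined in the context) to the scores $\tilde r_i$ yields the score-weighted term of the REINFORCE update in hidden-state space, namely the update $\frac{\eta}{N}\sum_{i=1}^N\tilde r_i\,\bm{y}_i$. The correspondence is exact in the simplified output-layer model when $W_{out}=I$, that is, $$\frac{\eta}{N}\sum_{i=1}^N\tilde r_i\,\bm{y}_i=\frac{\eta}{N}\sum_{i=1}^N\tilde r_i\,\nabla_h\log P(y_i\mid h).$$ For uncentered scores or a general output map $W_{out}$, it is a structural analogy rather than an equality.
   Context: The data are $N$ outputs $y_1,\dots,y_N$ generated for one fixed input, with embeddings $\bm{y}_i=\mathrm{embed}(y_i)\in\mathbb{R}^D$ and scalar scores $r_i\in\mathbb{R}$; $\bar r=\frac1N\sum_{i=1}^N r_i$. $\eta$ is a scaling factor (learning rate). Score-weighted attention construction: linear self-attention on a token matrix $E$ is $f_{lin}(E)=E+W^P W^V E\,(W^K E)^\top W^Q E$. The construction is a choice of weight matrices $W^K,W^Q,W^V,W^P$ for which linear self-attention on tokens $(\bm{y}_i,s_i)\in\mathbb{R}^{D+1}$ (embedding concatenated with score $s_i$) sends the query hidden state $h_q$ to $h_{out}=h_q+\frac{\eta}{N}\sum_{i=1}^N s_i\,\bm{y}_i$. Applying it to the centered scores means taking $s_i=\tilde r_i$. Simplified output-layer model: the output distribution given a hidden state $h\in\mathbb{R}^D$ is $P(y\mid h)\propto\exp\big(h^\top W_{out}\,\mathrm{embed}(y)\big)$, with output map $W_{out}$. REINFORCE update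 in hidden-state space: with rewards $s_i$ (centered: $s_i=\tilde r_i$; uncentered: $s_i=r_i$), it is $\frac{\eta}{N}\sum_{i=1}^N s_i\,\nabla_h\log P(y_i\mid h)$, the gradient being with respect to the hidden state. ''Structural analogy'' means that both updates are score-weighted updates of output embeddings, without being claimed equal.
   Formalization: The query token is taken as (h_q, 1) and is masked out as key and value in the linear self-attention; with the unmasked formula no weights give the stated h_out when η ≠ 0. Outputs range over a finite set. *)

(* Defs.v *)
From mathcomp Require Import all_boot all_order all_algebra.
From mathcomp Require Import all_classical all_reals all_analysis.
Import Order.TTheory GRing.Theory Num.Theory.
Import numFieldNormedType.Exports.

Set Implicit Arguments.
Unset Strict Implicit.
Unset Printing Implicit Defensive.

Local Open Scope ring_scope.

Definition mean_score (R : realType) (N : nat) (r : 'I_N -> R) : R :=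
  N%:R^-1 * \sum_(i < N) r i.

Definition centered (R : realType) (N : nat) (r : 'I_N -> R) (i : 'I_N) : R :=
  r i - mean_score r.

Definition score_weighted_update (R : realType) (D N : nat) (eta : R)
    (s : 'I_N -> R) (v : 'I_N -> 'cV[R]_D) : 'cV[R]_D :=
  (eta / N%:R) *: \sum_(i < N) s i *: v i.

(* Tokens are the columns of E.  M masks keys and values; M = 1%:M gives the
   plain formula E + WP WV E (WK E)^T WQ E. *)
Definition f_lin (R : realType) (d n : nat) (WK WQ WV WP : 'M[R]_d)
    (M : 'M[R]_n) (E : 'M[R]_(d, n)) : 'M[R]_(d, n) :=
  E + WP *m WV *m E *m M *m (WK *m E)^T *m WQ *m E.

(* Columns (y_i, s_i), followed by the query token (h, 1).  The constant 1 is
   what lets a linear query map produce a query vector independent of h. *)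
Definition tokens (R : realType) (D N : nat) (y : 'I_N -> 'cV[R]_D)
    (s : 'I_N -> R) (h : 'cV[R]_D) : 'M[R]_(D + 1, N + 1) :=
  block_mx (\matrix_(k < D, i < N) y i k 0) h (\row_(i < N) s i) 1%:M.

(* The query token serves as query only.  If it were also a key and a value,
   the update would pick up an additional term (eta / N) h. *)
Definition query_mask (R : realType) (N : nat) : 'M[R]_(N + 1) :=
  block_mx 1%:M 0 0 0.

Definition attention_out (R : realType) (D N : nat)
    (WK WQ WV WP : 'M[R]_(D + 1)) (y : 'I_N -> 'cV[R]_D) (s : 'I_N -> R)
    (h : 'cV[R]_D) : 'cV[R]_D :=
  ursubmx (f_lin WK WQ WV WP (query_mask R N) (tokens y s h)).

Definition score_weighted_attention (R : realType) (D N : nat) (eta : R)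
    (WK WQ WV WP : 'M[R]_(D + 1)) : Prop :=
  forall (y : 'I_N -> 'cV[R]_D) (s : 'I_N -> R) (h : 'cV[R]_D),
    attention_out WK WQ WV WP y s h = h + score_weighted_update eta s y.

Definition logit (R : realType) (D : nat) (Y : finType) (W : 'M[R]_D)
    (embed : Y -> 'cV[R]_D) (h : 'cV[R]_D) (y : Y) : R :=
  (h^T *m W *m embed y) 0 0.

Definition output_prob (R : realType) (D : nat) (Y : finType) (W : 'M[R]_D)
    (embed : Y -> 'cV[R]_D) (h : 'cV[R]_D) (y : Y) : R :=
  expR (logit W embed h y) / \sum_(z : Y) expR (logit W embed h z).

Definition log_prob (R : realType) (D : nat) (Y : finType) (W : 'M[R]_D)
    (embed : Y -> 'cV[R]_D) (y : Y) (h : 'cV[R]_D) : R :=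
  ln (output_prob W embed h y).

Definition expected_embed (R : realType) (D : nat) (Y : finType) (W : 'M[R]_D)
    (embed : Y -> 'cV[R]_D) (h : 'cV[R]_D) : 'cV[R]_D :=
  \sum_(z : Y) output_prob W embed h z *: embed z.

Definition gradient (R : realType) (D : nat) (f : 'cV[R]_D -> R)
    (h : 'cV[R]_D) : 'cV[R]_D :=
  \col_(j < D) ('D_(delta_mx j 0) f h).

Definition reinforce_update (R : realType) (D N : nat) (Y : finType) (eta : R)
    (W : 'M[R]_D) (embed : Y -> 'cV[R]_D) (y : 'I_N -> Y) (s : 'I_N -> R)
    (h : 'cV[R]_D) : 'cV[R]_D :=
  score_weighted_update eta s (fun i => gradient (log_prob W embed (y i)) h).

(* Main.v *)
(** The gradient of [log P(y | h)] is [W (embed y - E)], with [E] the expected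
    embedding under [P(. | h)].  The [E] terms of the REINFORCE update add up to
    [eta * mean_score s] times [W E], which vanishes for centered scores.  For
    uncentered scores a constant embedding makes the REINFORCE update zero but
    not the attention update; for [W <> 1] and centered scores the two updates
    are [u] and [W u], and [u] can be a multiple of a vector that [W] moves. *)
Require Import Defs.
From HB Require Import structures.
From mathcomp Require Import all_boot all_order all_algebra.
From mathcomp Require Import all_classical all_reals all_analysis.
Import Order.TTheory GRing.Theory Num.Theory.
Import numFieldNormedType.Exports.

Set Implicit Arguments.
Unset Strict Implicit.
Unset Printing Implicit Defensive.

Local Open Scope ring_scope.

Lemma score_weighted_updateB (R : realType) (D N : nat) (eta : R)
    (s : 'I_N -> R) (v w : 'I_N -> 'cV[R]_D) :
  score_weighted_update eta s (fun i => v i - w i)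
    = score_weighted_update eta s v - score_weighted_update eta s w.
Proof.
rewrite /score_weighted_update -scalerBr -sumrB.
by under eq_bigr do rewrite scalerBr.
Qed.

Lemma score_weighted_update_mulmx (R : realType) (D N : nat) (eta : R)
    (s : 'I_N -> R) (W : 'M[R]_D) (v : 'I_N -> 'cV[R]_D) :
  score_weighted_update eta s (fun i => W *m v i)
    = W *m score_weighted_update eta s v.
Proof.
rewrite /score_weighted_update -scalemxAr mulmx_sumr.
by under eq_bigr do rewrite scalemxAr.
Qed.

(** Used for the expected embedding, which is the same for all samples, and for the attention update
    under a constant embedding. *)
Lemma score_weighted_update_cst (R : realType) (D N : nat) (eta : R)
    (s : 'I_N -> R) (c : 'cV[R]_D) :
  score_weighted_update eta s (fun=> c) = (eta * mean_score s) *: c.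
Proof. by rewrite /score_weighted_update -scaler_suml scalerA mulrA. Qed.

Lemma mean_score_centered (R : realType) (N : nat) (r : 'I_N -> R) :
  (0 < N)%N -> mean_score (centered r) = 0.
Proof.
move=> N0; rewrite /mean_score /centered sumrB sumr_const card_ord mulrBr.
by rewrite -[X in _ - _ * X]mulr_natl mulrA mulVf ?pnatr_eq0 -?lt0n// mul1r subrr.
Qed.

Lemma score_weighted_attention_exists (R : realType) (D N : nat) (eta : R) :
  exists WK WQ WV WP : 'M[R]_(D + 1),
    @score_weighted_attention R D N eta WK WQ WV WP.
Proof.
(* The query (h, 1) is projected to (0, 1), so that its inner product with the
   key (y_i, s_i) is s_i. *)
exists 1%:M, (block_mx 0 0 0 1%:M), 1%:M, (eta / N%:R)%:M => y s h.
rewrite /attention_out /f_lin /tokens /query_mask mulmx1 mul1mx.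
rewrite mul_scalar_mx -!scalemxAl tr_block_mx !mulmx_block.
rewrite !(mulmx0, mul0mx, mulmx1, mul1mx, addr0, add0r).
(* Only the upper right block is read off, so it does no harm that [WV] and [WP] also act on the
   score row. *)
rewrite scale_block_mx add_block_mx block_mxKur; congr (_ + _ *: _).
apply/matrixP => k j; rewrite ord1 !mxE summxE.
by apply: eq_bigr => i _; rewrite !mxE mulrC.
Qed.

Lemma logitE (R : realType) (D : nat) (Y : finType) (W : 'M[R]_D)
    (embed : Y -> 'cV[R]_D) (h : 'cV[R]_D) (y : Y) :
  logit W embed h y = \sum_(j < D) h j 0 * (W *m embed y) j 0.
Proof.
by rewrite /logit -mulmxA mxE; apply: eq_bigr => j _; rewrite mxE.
Qed.

Lemma is_diff_sumr (R : numFieldType) (V W : normedModType R) (I : Type)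
    (s : seq I) (f df : I -> V -> W) (x : V) :
  (forall i, is_diff x (f i) (df i)) ->
  is_diff x (fun u => \sum_(i <- s) f i u) (fun u => \sum_(i <- s) df i u).
Proof.
move=> fdf; elim: s => [|i s IH].
  under eq_fun do rewrite big_nil.
  by under [X in is_diff _ _ X]eq_fun do rewrite big_nil; exact: is_diff_cst.
under eq_fun do rewrite big_cons.
under [X in is_diff _ _ X]eq_fun do rewrite big_cons.
exact: is_diffD.
Qed.

(** Chain rule for a scalar outer function, whose differential is multiplication by its derivative;
    it serves for [expR] and [ln]. *)
Lemma is_diff_comp_derive (R : numFieldType) (V : normedModType R)
    (f df : V -> R) (g : R -> R) (dg : R) (x : V) :
  is_diff x f df -> is_derive (f x) 1 g dg ->
  is_diff x (g \o f) (fun v => df v * dg).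
Proof.
move=> fdf [/derivable1_diffP gd gE].
suff ? : is_diff (f x) g (fun t => t * dg) by exact: is_diff_comp.
by apply: DiffDef => //; rewrite diff1E// derive1E gE.
Qed.

(** The logit is a finite linear combination of the coordinates of [h], hence its own
    differential. *)
Lemma is_diff_logit (R : realType) (D : nat) (Y : finType) (W : 'M[R]_D)
    (embed : Y -> 'cV[R]_D) (y : Y) (h : 'cV[R]_D) :
  is_diff h (fun u => logit W embed u y) (fun u => logit W embed u y).
Proof.
have coord (j : 'I_D) : is_diff h (fun u : 'cV[R]_D => u j 0) (fun u => u j 0).
  have lin : linear (fun u : 'cV[R]_D => u j 0 : R^o).
    by move=> a u v; rewrite !mxE.
  pose L : {linear 'cV[R]_D -> R^o} :=
    HB.pack (fun u : 'cV[R]_D => u j 0 : R^o)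
      (GRing.isLinear.Build _ _ _ _ _ lin).
  apply: DiffDef; first exact: differentiable_coord.
  by rewrite (@diff_lin _ _ _ L)//; exact: coord_continuous.
under eq_fun do rewrite logitE.
apply: is_diff_sumr => j.
under eq_fun do rewrite mulrC.
exact: is_diffZ.
Qed.

(** The element [y] witnesses that [Y] is inhabited; the empty sum would be 0. *)
Lemma sum_expR_logit_gt0 (R : realType) (D : nat) (Y : finType) (W : 'M[R]_D)
    (embed : Y -> 'cV[R]_D) (y : Y) (h : 'cV[R]_D) :
  0 < \sum_(z : Y) expR (logit W embed h z).
Proof.
rewrite (bigD1 y)//= ltr_wpDr ?expR_gt0//.
by apply: sumr_ge0 => z _; exact: expR_ge0.
Qed.

Lemma log_probE (R : realType) (D : nat) (Y : finType) (W : 'M[R]_D)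
    (embed : Y -> 'cV[R]_D) (y : Y) (h : 'cV[R]_D) :
  log_prob W embed y h
    = logit W embed h y - ln (\sum_(z : Y) expR (logit W embed h z)).
Proof.
by rewrite /log_prob /output_prob ln_div ?expRK// posrE
  ?expR_gt0 ?(sum_expR_logit_gt0 _ _ y).
Qed.

(** Differentiating the log-sum-exp term averages the differentials of the logits with the softmax
    probabilities as weights, which produces the expected embedding. *)
Lemma is_diff_log_prob (R : realType) (D : nat) (Y : finType) (W : 'M[R]_D)
    (embed : Y -> 'cV[R]_D) (y : Y) (h : 'cV[R]_D) :
  is_diff h (log_prob W embed y)
    (fun v => (v^T *m (W *m (embed y - expected_embed W embed h))) 0 0).
Proof.
have Z0 := sum_expR_logit_gt0 W embed y h.
have dexp z : is_diff h (fun u => expR (logit W embed u z))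
    (fun v => logit W embed v z * expR (logit W embed h z)).
  exact: (is_diff_comp_derive (is_diff_logit _ _ _ _) (is_derive_expR _)).
have dln := is_diff_comp_derive (is_diff_sumr (index_enum Y) dexp)
  (is_derive1_ln Z0).
have -> : log_prob W embed y = (fun u => logit W embed u y) -
    (ln (R:=R) \o (fun u => \sum_(z : Y) expR (logit W embed u z))).
  by apply/funext => u; rewrite log_probE.
apply: is_diff_eq; first exact: is_diffB (is_diff_logit _ _ _ _) dln.
apply/funext => v; rewrite fctE mulmxA mulmxBr [RHS]mxE [X in _ = _ + X]mxE; congr (_ - _).
rewrite /expected_embed mulmx_sumr summxE mulr_suml.
by apply: eq_bigr => z _; rewrite -scalemxAr mxE -mulrA mulrC.
Qed.

Lemma gradient_log_prob (R : realType) (D : nat) (Y : finType) (W : 'M[R]_D)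
    (embed : Y -> 'cV[R]_D) (y : Y) (h : 'cV[R]_D) :
  gradient (log_prob W embed y) h
    = W *m (embed y - expected_embed W embed h).
Proof.
have [dl dE] := is_diff_log_prob W embed y h.
apply/matrixP => j k; rewrite ord1 mxE deriveE// dE.
by rewrite trmx_delta -rowE mxE.
Qed.

Lemma reinforce_updateE (R : realType) (D N : nat) (Y : finType) (eta : R)
    (W : 'M[R]_D) (embed : Y -> 'cV[R]_D) (y : 'I_N -> Y) (s : 'I_N -> R)
    (h : 'cV[R]_D) :
  reinforce_update eta W embed y s h
    = W *m (score_weighted_update eta s (embed \o y)
            - (eta * mean_score s) *: expected_embed W embed h).
Proof.
rewrite -score_weighted_update_cst -score_weighted_updateB.
rewrite -score_weighted_update_mulmx /reinforce_update.
congr (score_weighted_update eta s _).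
by apply/funext => i; rewrite gradient_log_prob.
Qed.

Lemma reinforce_update_centered (R : realType) (D N : nat) (Y : finType)
    (eta : R) (W : 'M[R]_D) (embed : Y -> 'cV[R]_D) (y : 'I_N -> Y)
    (r : 'I_N -> R) (h : 'cV[R]_D) : (0 < N)%N ->
  reinforce_update eta W embed y (centered r) h
    = W *m score_weighted_update eta (centered r) (embed \o y).
Proof.
by move=> N0; rewrite reinforce_updateE mean_score_centered// mulr0 scale0r subr0.
Qed.

(** The probabilities sum to 1, so the expected embedding is [c] and every gradient vanishes. A
    sample index gives an element of [Y], which makes the normalizing sum positive. *)
Lemma reinforce_update_cst (R : realType) (D N : nat) (Y : finType) (eta : R)
    (W : 'M[R]_D) (c : 'cV[R]_D) (y : 'I_N -> Y) (s : 'I_N -> R)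
    (h : 'cV[R]_D) :
  (0 < N)%N -> reinforce_update eta W (fun=> c) y s h = 0.
Proof.
move=> N0; have Z0 := sum_expR_logit_gt0 W (fun=> c) (y (Ordinal N0)) h.
suff c_mean : expected_embed W (fun _ : Y => c) h = c.
  by rewrite reinforce_updateE c_mean -score_weighted_update_cst subrr mulmx0.
by rewrite /expected_embed -scaler_suml -mulr_suml divff ?gt_eqF// scale1r.
Qed.

(** The columns of [W] are the images of the basis vectors; if all of these were fixed, [W] would be
    the identity. *)
Lemma neq1_mulmx_neq (R : nzRingType) (D : nat) (W : 'M[R]_D) :
  W != 1%:M -> exists x : 'cV[R]_D, W *m x != x.
Proof.
move=> W1; apply: contrapT => /forallNP Wid; move/eqP: W1; apply.
apply/matrixP => i j; move: (Wid (delta_mx j 0)) => /negP/negPn/eqP.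
by rewrite -colE => /matrixP/(_ i 0); rewrite !mxE eqxx andbT.
Qed.

Theorem theorem3p5 (R : realType) (D N : nat) (eta : R)
    (hD : (0 < D)%N) (hN : (0 < N)%N) :
  (* the construction exists *)
  (exists WK WQ WV WP : 'M[R]_(D + 1),
     @score_weighted_attention R D N eta WK WQ WV WP) /\
  (forall WK WQ WV WP : 'M[R]_(D + 1),
     @score_weighted_attention R D N eta WK WQ WV WP ->
     (* applied to centered scores *)
     (forall (Y : finType) (embed : Y -> 'cV[R]_D) (y : 'I_N -> Y)
             (r : 'I_N -> R) (h : 'cV[R]_D),
        attention_out WK WQ WV WP (embed \o y) (centered r) h - h
          = score_weighted_update eta (centered r) (embed \o y)) /\
     (* the REINFORCE update, for arbitrary scores and output map: its
        score-weighted term, and its form as a score-weighted update *)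
     (forall (Y : finType) (W : 'M[R]_D) (embed : Y -> 'cV[R]_D)
             (y : 'I_N -> Y) (s : 'I_N -> R) (h : 'cV[R]_D),
        [/\ forall a : Y, differentiable (log_prob W embed a) h,
            reinforce_update eta W embed y s h
              = score_weighted_update eta s (fun i => W *m embed (y i))
                - score_weighted_update eta s
                    (fun=> W *m expected_embed W embed h) &
            reinforce_update eta W embed y s h
              = score_weighted_update eta s
                  (fun i => W *m (embed (y i) - expected_embed W embed h))]) /\
     (* exactness for centered scores and identity output map *)
     (forall (Y : finType) (embed : Y -> 'cV[R]_D) (y : 'I_N -> Y)
             (r : 'I_N -> R) (h : 'cV[R]_D),
        score_weighted_update eta (centered r) (embed \o y)
          = reinforce_update eta 1%:M embed y (centered r) h) /\
     (* no equality in general for uncentered scores *)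
     (eta != 0 ->
      forall (Y : finType) (y : 'I_N -> Y) (r : 'I_N -> R),
        mean_score r != 0 ->
        exists embed : Y -> 'cV[R]_D, forall h : 'cV[R]_D,
          attention_out WK WQ WV WP (embed \o y) r h - h
            <> reinforce_update eta 1%:M embed y r h) /\
     (* no equality in general for another output map *)
     (eta != 0 -> (1 < N)%N ->
      forall (Y : finType) (W : 'M[R]_D), (1 < #|Y|)%N -> W != 1%:M ->
        exists (embed : Y -> 'cV[R]_D) (y : 'I_N -> Y) (r : 'I_N -> R),
          forall h : 'cV[R]_D,
            attention_out WK WQ WV WP (embed \o y) (centered r) h - h
              <> reinforce_update eta W embed y (centered r) h)).
Proof.
split; first exact: score_weighted_attention_exists.
move=> WK WQ WV WP attn.
have attnE (y : 'I_N -> 'cV[R]_D) s h :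
    attention_out WK WQ WV WP y s h - h = score_weighted_update eta s y.
  by rewrite attn addrC addKr.
split; first by move=> *; exact: attnE.
split.
  move=> Y W embed y s h; rewrite score_weighted_update_mulmx.
  rewrite !score_weighted_update_mulmx score_weighted_updateB.
  rewrite !score_weighted_update_cst -mulmxBr reinforce_updateE; split => // a.
  (* Differentiability makes the vector of partial derivatives in [gradient] a genuine gradient. *)
  by have [] := is_diff_log_prob W embed a h.
split.
  by move=> Y embed y r h; rewrite reinforce_update_centered// mul1mx.
split.
  move=> eta0 Y y r r0; exists (fun=> const_mx 1) => h.
  rewrite attnE reinforce_update_cst// score_weighted_update_cst.
  (* Every coordinate of the attention update is [eta * mean_score r]; [hD] provides one to compare
     with 0. *)
  move/matrixP/(_ (Ordinal hD) 0); rewrite !mxE mulr1 => /eqP.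
  by rewrite mulf_eq0 (negPf eta0) (negPf r0).
move=> eta0 N1 Y W /card_gt1P[a [b [_ _ ab]]] /neq1_mulmx_neq[x Wx].
(* Sample [i0] is embedded as [x] and all others as 0, so only its term survives in the update. *)
pose i0 := Ordinal hN; pose r (i : 'I_N) : R := (i == i0)%:R.
pose embed (z : Y) := if z == a then x else 0.
exists embed, (fun i => if i == i0 then a else b), r => h.
rewrite attnE reinforce_update_centered//.
set u := score_weighted_update _ _ _.
have [c c0 ->] : exists2 c, c != 0 & u = c *: x.
  (* The factor [1 - N%:R^-1] is the centered score of [i0], nonzero because [1 < N]. *)
  exists (eta / N%:R * (1 - N%:R^-1)).
    rewrite !mulf_neq0 ?invr_eq0 ?pnatr_eq0 -?lt0n//.
    by rewrite subr_eq0 eq_sym invr_eq1 pnatr_eq1 gtn_eqF.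
  rewrite /u /score_weighted_update -[RHS]scalerA; congr (_ *: _).
  rewrite (bigD1 i0)//= /embed eqxx big1 => [|i /negPf ->]; last first.
    by rewrite eq_sym (negPf ab) scaler0.
  rewrite addr0 /centered /mean_score /r eqxx (bigD1 i0)//=.
  by rewrite big1 ?addr0 ?mulr1// => i /negPf ->.
rewrite -scalemxAr => /(scalerI c0) xW.
by rewrite -xW eqxx in Wx.
Qed.
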